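(* Let $n=2m$, let $r\ge 0$ be an integer, and let $\Lambda\in\mathbb{F}_{2^m}[x]$ be a linearized polynomial that is a permutation of $\mathbb{F}_{2^m}$. Let $F:\mathbb{F}_{2^n}\to\mathbb{F}_{2^n}$, $F(x)=x^{2^r}\,\mathrm{Tr}^n_m(\Lambda(x))$, and let $H:\mathbb{F}_{2^m}\to\mathbb{F}_{2^m}$, $H(x)=x^{2^r}\Lambda(x)$. Then for every nonzero $\alpha\in\mathbb{F}_{2^m}$ and every $\beta\in\mathbb{F}_{2^n}$: if $\beta\notin\mathbb{F}_{2^m}$ then $\mathcal{W}_F(\alpha,\beta)=0$, and if $\beta\in\mathbb{F}_{2^m}$ then $$\mathcal{W}_F(\alpha,\beta)=2^m\,\mathcal{W}_H(\alpha,\beta).$$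
   Context: A linearized polynomial over $\mathbb{F}_{2^m}$ is one of the form $\sum_i c_i x^{2^i}$ with $c_i\in\mathbb{F}_{2^m}$. $\mathrm{Tr}_k$ is the absolute trace $\mathbb{F}_{2^k}\to\mathbb{F}_2$, and $\mathrm{Tr}^n_m(x)=x+x^{2^m}$ is the relative trace $\mathbb{F}_{2^n}\to\mathbb{F}_{2^m}$. The Walsh transforms, with the first argument indexing the component function, are $\mathcal{W}_F(\alpha,\beta)=\sum_{x\in\mathbb{F}_{2^n}}(-1)^{\mathrm{Tr}_n(\alpha F(x))+\mathrm{Tr}_n(\beta x)}$ and $\mathcal{W}_H(\alpha,\beta)=\sum_{z\in\mathbb{F}_{2^m}}(-1)^{\mathrm{Tr}_m(\alpha H(z))+\mathrm{Tr}_m(\beta z)}$. *)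

(* Defs.v *)
From HB Require Import structures.
From mathcomp Require Import all_boot all_order all_algebra all_fingroup all_field.

Set Implicit Arguments.
Unset Strict Implicit.
Unset Printing Implicit Defensive.

Import GRing.Theory.
Local Open Scope ring_scope.

Definition linearized (K : nzRingType) (p : {poly K}) : Prop :=
  exists (d : nat) (c : nat -> K), p = \sum_(i < d) c i *: 'X^(2 ^ i).

(* When #|K| = 2 ^ k, the sum of conjugates x + x^2 + ... + x^(2^(k-1)) lies in
   the prime field {0, 1} of K; abs_trace reads it as an element of 'F_2, see
   abs_traceE. *)
Definition abs_trace (K : finFieldType) (k : nat) (x : K) : 'F_2 :=
  if \sum_(i < k) x ^+ (2 ^ i) == 0 then 0 else 1.

Lemma abs_traceE (K : finFieldType) (k : nat) (x : K) :
  #|K| = (2 ^ k)%N -> (abs_trace k x : nat)%:R = \sum_(i < k) x ^+ (2 ^ i).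
Proof.
move=> cK; have pK : 2 \in [pchar K] by apply: card_finPcharP cK _.
rewrite /abs_trace; case: eqP => [-> //|/eqP nz0].
set t := \sum_(i < k) _ in nz0 *; symmetry.
suff t2 : t ^+ 2 = t by apply: (mulfI nz0); rewrite mulr1 -expr2.
rewrite /t -(pFrobenius_autE pK) rmorph_sum /=.
under eq_bigr => i _ do rewrite pFrobenius_autE -exprM -expnSr.
case: k cK @t nz0 => [|k] cK t nz0; first by rewrite !big_ord0.
rewrite big_ord_recr big_ord_recl /= -cK expf_card expn0 expr1 addrC.
by congr (_ + _); apply: eq_bigr.
Qed.

(* The codomain GF(2^m) is seen inside L = GF(2^(2m)). *)
Definition rel_trace (L : nzRingType) (m : nat) (x : L) : L := x + x ^+ (2 ^ m).

(* The exponent is added in 'F_2, then read as the natural number 0 or 1. *)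
Definition walsh (K : finFieldType) (k : nat) (f : K -> K) (a b : K) : int :=
  \sum_(x : K)
    (-1) ^+ nat_of_ord (abs_trace k (a * f x) + abs_trace k (b * x)).

(* Main.v *)
(* The relative trace T : L -> K is K-linear and onto, and it commutes with Lam,
   so with the additive character chi = (-1)^Tr_m of K, transitivity of the
   trace gives (-1)^Tr_n(alpha F(x)) = chi(alpha H(T x)).  Fix w with T w = 1 and
   write x = z w + u with z, u in K, so that T x = z and T(beta u) = u T(beta).
   The sum over u of chi(u T(beta)) is 0 unless T(beta) = 0, i.e. unless beta
   lies in K, in which case it is 2^m and the sum over z is W_H. *)
Require Import Defs.
From HB Require Import structures.
From mathcomp Require Import all_boot all_order all_algebra all_fingroup all_field.

Set Implicit Arguments.
Unset Strict Implicit.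
Unset Printing Implicit Defensive.

Import GRing.Theory.
Local Open Scope ring_scope.

(** * Powers of two in characteristic 2 and linearized polynomials *)

Lemma pchar2_card (K : finFieldType) (k : nat) :
  #|K| = (2 ^ k)%N -> 2 \in [pchar K].
Proof. by move=> cK; apply: card_finPcharP cK _. Qed.

Lemma card_pow2_gt0 (K : finFieldType) (k : nat) : #|K| = (2 ^ k)%N -> (0 < k)%N.
Proof. by case: k => // cK; have := finNzRing_gt1 K; rewrite cK. Qed.

Lemma exprD_pow2 (R : comNzRingType) (i : nat) (x y : R) :
  2 \in [pchar R] -> (x + y) ^+ (2 ^ i) = x ^+ (2 ^ i) + y ^+ (2 ^ i).
Proof.
by move=> pR; apply: exprDn_pchar; rewrite pnatX pnatE // pR.
Qed.

Lemma expr_sum_pow2 (R : comNzRingType) (i d : nat) (f : nat -> R) :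
  2 \in [pchar R] ->
  (\sum_(j < d) f j) ^+ (2 ^ i) = \sum_(j < d) f j ^+ (2 ^ i).
Proof.
move=> pR; elim: d => [|d IHd]; first by rewrite !big_ord0 expr0n expn_eq0.
by rewrite !big_ord_recr exprD_pow2 // IHd.
Qed.

Lemma pow2_iterE (R : nzRingType) (i j : nat) (x : R) :
  x ^+ (2 ^ i) ^+ (2 ^ j) = x ^+ (2 ^ (i + j)).
Proof. by rewrite -exprM -expnD. Qed.

Lemma horner_linearized_map (K L : comNzRingType) (f : {rmorphism K -> L})
    (d : nat) (c : nat -> K) (x : L) :
  (map_poly f (\sum_(i < d) c i *: 'X^(2 ^ i))).[x]
  = \sum_(i < d) f (c i) * x ^+ (2 ^ i).
Proof.
rewrite rmorph_sum horner_sum; apply: eq_bigr => i _.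
by rewrite /= map_polyZ map_polyXn hornerZ hornerXn.
Qed.

Lemma horner_linearized (K : comNzRingType) (d : nat) (c : nat -> K) (x : K) :
  (\sum_(i < d) c i *: 'X^(2 ^ i)).[x] = \sum_(i < d) c i * x ^+ (2 ^ i).
Proof.
by rewrite horner_sum; apply: eq_bigr => i _; rewrite hornerZ hornerXn.
Qed.

(** * The additive character given by the absolute trace *)

Definition chi (K : finFieldType) (k : nat) (x : K) : int :=
  (-1) ^+ nat_of_ord (abs_trace k x).

Lemma signF2D (a b : 'F_2) :
  (-1) ^+ nat_of_ord (a + b) = (-1) ^+ nat_of_ord a * (-1) ^+ nat_of_ord b :> int.
Proof. by case: a b => [[|[|a]] //= ?] [[|[|b]] //= ?]. Qed.

Lemma walshE (K : finFieldType) (k : nat) (f : K -> K) (a b : K) :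
  walsh k f a b = \sum_(x : K) chi k (a * f x) * chi k (b * x).
Proof. by apply: eq_bigr => x _; rewrite signF2D. Qed.

Section Character.
Variables (K : finFieldType) (k : nat).
Hypothesis cardK : #|K| = (2 ^ k)%N.

Let pK : 2 \in [pchar K] := pchar2_card cardK.

(** Both sides are compared inside [K], where [abs_traceE] turns them into sums of conjugates and
    the Frobenius powers are additive. *)
Lemma abs_traceD (x y : K) : abs_trace k (x + y) = abs_trace k x + abs_trace k y.
Proof.
have injF (a b : 'F_2) : (a : nat)%:R = (b : nat)%:R :> K -> a = b.
  case: a b => [[|[|a]] //= ?] [[|[|b]] //= ?] /eqP;
  by [move=> _; apply: val_inj | rewrite ?[_ == 1%:R]eq_sym oner_eq0].
(* Adding in ['F_2] and adding representatives differ only at 1 + 1, and 2 = 0 in [K]. *)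
have natD (a b : 'F_2) : (a + b : nat)%:R = (nat_of_ord (a + b)%R)%:R :> K.
  case: a b => [[|[|a]] //= ?] [[|[|b]] //= ?]; by rewrite // (pcharf0 pK).
apply: injF; rewrite -natD natrD !abs_traceE // -big_split.
by apply: eq_bigr => i _; rewrite exprD_pow2.
Qed.

Lemma chiD (x y : K) : chi k (x + y) = chi k x * chi k y.
Proof. by rewrite /chi abs_traceD signF2D. Qed.

Lemma chi0 : chi k (0 : K) = 1.
Proof.
rewrite /chi /abs_trace big1 ?eqxx // => i _.
by rewrite expr0n expn_eq0.
Qed.

(** The trace polynomial has degree at most 2^(k-1), less than the order of [K], so it cannot vanish
    on all of [K]. *)
Lemma chi_nontrivial : exists x : K, chi k x = -1.
Proof.
have k_gt0 := card_pow2_gt0 cardK.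
pose p : {poly K} := \sum_(i < k) 'X^(2 ^ i).
have size_lt (d : nat) : (size (\sum_(i < d) 'X^(2 ^ i) : {poly K})%R
                           <= (2 ^ d.-1).+1)%N.
  apply: (leq_trans (size_sum _ _ _)); apply/bigmax_leqP => i _.
  rewrite size_polyXn ltnS leq_exp2l //.
  by case: d i => [[]|d i] //; rewrite -ltnS.
have p_neq0 : p != 0.
  (* The coefficient of X is 1: it comes from the term i = 0 alone. *)
  apply/eqP => /(congr1 (fun q : {poly K} => q`_1)).
  rewrite coef0 coef_sum; case: (k) k_gt0 => // d _.
  rewrite big_ord_recl coefXn /= big1 => [/eqP|i _]; first by rewrite addr0 oner_eq0.
  by rewrite coefXn -(expn0 2) eqn_exp2l.
have [x px] : exists x, ~~ root p x.
  apply/existsP; apply: contraT; rewrite negb_exists => /forallP rootp.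
  have := max_poly_roots p_neq0 _ (enum_uniq K).
  rewrite -cardE cardK => /(_ _)/leq_trans/(_ (size_lt k)).
  rewrite ltnS leq_exp2l // => le.
  suff: (k <= k.-1)%N by case: (k) k_gt0 => // d _; rewrite ltnn.
  by apply: le; apply/allP => x _; have := rootp x; rewrite negbK.
exists x; rewrite /chi /abs_trace.
move: px; rewrite rootE horner_sum.
under eq_bigr => i _ do rewrite hornerXn.
by move/negPf->.
Qed.

(** Rescaling [u] reduces to c = 1; translating by a [v] with chi(v) = -1 then negates the sum. *)
Lemma sum_chi_mul (c : K) : c != 0 -> \sum_(u : K) chi k (u * c) = 0.
Proof.
move=> c0; rewrite (reindex (fun u => u / c)) /=; last first.
  by exists (fun u => u * c) => u _; rewrite ?mulfVK ?mulfK.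
under eq_bigr => u _ do rewrite mulfVK //.
have [v chiv] := chi_nontrivial.
have : \sum_(u : K) chi k u = - \sum_(u : K) chi k u.
  rewrite [LHS](reindex (fun u => u + v)) /=; last first.
    by exists (fun u => u - v) => u _; rewrite ?addrK ?subrK.
  by rewrite -sumrN; apply: eq_bigr => u _; rewrite chiD chiv mulrN1.
by move/eqP; rewrite eq_sym Num.Theory.eqNr => /eqP.
Qed.

End Character.

(** * The relative trace from [L] to [K] *)

Section RelativeTrace.
Variables (m : nat) (K L : finFieldType).
Hypotheses (cardK : #|K| = (2 ^ m)%N) (cardL : #|L| = (2 ^ (2 * m))%N).
Variable iota : {rmorphism K -> L}.

Let pL : 2 \in [pchar L] := pchar2_card cardL.

Lemma iota_pow2 (a : K) : iota a ^+ (2 ^ m) = iota a.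
Proof. by rewrite -rmorphXn -cardK expf_card. Qed.

(** X^(2^m) - X is the product of the X - x for x in [K]; at a fixed [y] one of the mapped factors
    must vanish. *)
Lemma codom_fixed (y : L) : y ^+ (2 ^ m) = y -> y \in codom iota.
Proof.
move=> fixy; have /(congr1 (map_poly iota)) := finField_genPoly K.
rewrite rmorphB /= map_polyXn map_polyX rmorph_prod /= cardK.
move/(congr1 (horner^~ y)); rewrite !hornerE fixy subrr horner_prod.
move/esym/eqP; case/prodf_eq0 => x _; rewrite rmorphB /= map_polyX map_polyC.
by rewrite !hornerE subr_eq0 => /eqP->; apply: codom_f.
Qed.

Lemma rel_traceD (x y : L) : rel_trace m (x + y) = rel_trace m x + rel_trace m y.
Proof. by rewrite /rel_trace exprD_pow2 // addrACA. Qed.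

Lemma rel_traceZ (a : K) (x : L) :
  rel_trace m (iota a * x) = iota a * rel_trace m x.
Proof. by rewrite /rel_trace exprMn iota_pow2 mulrDr. Qed.

Lemma rel_traceX (i : nat) (x : L) :
  rel_trace m (x ^+ (2 ^ i)) = rel_trace m x ^+ (2 ^ i).
Proof. by rewrite /rel_trace exprD_pow2 // !pow2_iterE addnC. Qed.

Lemma rel_trace_sum (d : nat) (f : nat -> L) :
  rel_trace m (\sum_(i < d) f i) = \sum_(i < d) rel_trace m (f i).
Proof. by rewrite /rel_trace expr_sum_pow2 // -big_split. Qed.

(** Raising to the power 2^m swaps the two summands, because x^(2^(2m)) = x in [L]. *)
Lemma rel_trace_codom (x : L) : rel_trace m x \in codom iota.
Proof.
apply: codom_fixed; rewrite -rel_traceX /rel_trace pow2_iterE addnn -mul2n.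
by rewrite -cardL expf_card addrC.
Qed.

Lemma rel_trace_eq0 (x : L) : (rel_trace m x == 0) = (x \in codom iota).
Proof.
rewrite /rel_trace addr_eq0 (oppr_pchar2 pL).
apply/eqP/idP => [/esym/codom_fixed //|/codomP[a ->]].
by rewrite iota_pow2.
Qed.

Lemma rel_trace_lift : exists T : L -> K, forall x, iota (T x) = rel_trace m x.
Proof.
apply: (fin_all_exists (P := fun x a => iota a = rel_trace m x)) => x.
by have /codomP[a ->] := rel_trace_codom x; exists a.
Qed.

(** The relative trace commutes with each monomial x^(2^i), and the coefficients, coming from [K],
    pass through it. *)
Lemma rel_trace_horner (T : L -> K) (p : {poly K}) (x : L) :
    (forall x, iota (T x) = rel_trace m x) -> linearized p ->
  rel_trace m (map_poly iota p).[x] = iota p.[T x].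
Proof.
move=> TE [d [c ->]]; rewrite horner_linearized_map horner_linearized.
rewrite (rel_trace_sum d (fun i => iota (c i) * x ^+ (2 ^ i))) rmorph_sum.
by apply: eq_bigr => i _; rewrite rel_traceZ rel_traceX -TE rmorphM rmorphXn.
Qed.

(** Transitivity of the trace: the conjugates of [y] with indices i and m + i add up to the i-th
    conjugate of its relative trace. *)
Lemma chi_rel_trace (y : L) (z : K) :
  iota z = rel_trace m y -> chi (2 * m) y = chi m z.
Proof.
move=> zE; rewrite /chi /abs_trace -(fmorph_eq0 iota) rmorph_sum.
suff -> : \sum_(i < 2 * m) y ^+ (2 ^ i) = \sum_(i < m) iota (z ^+ (2 ^ i)) by [].
rewrite mul2n -addnn big_split_ord /= -big_split; apply: eq_bigr => i _ /=.
by rewrite rmorphXn zE -rel_traceX /rel_trace pow2_iterE addnC.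
Qed.

(** Any [y] outside the image of [K] has a nonzero relative trace a in [K]; dividing [y] by a gives
    [w]. *)
Lemma rel_trace_eq1 : exists w : L, rel_trace m w = 1.
Proof.
have [y yP] : exists y, y \notin codom iota.
  apply/existsP; apply: contraT; rewrite negb_exists => /forallP inK.
  have : (#|L| <= #|codom iota|)%N.
    by apply/subset_leq_card/subsetP => y _; have := inK y; rewrite negbK.
  rewrite (card_codom (fmorph_inj iota)) cardL cardK leq_exp2l //.
  by rewrite mul2n -addnn -{3}[m]addn0 leq_add2l leqNgt (card_pow2_gt0 cardK).
have /codomP[a aE] := rel_trace_codom y.
exists (iota a^-1 * y); rewrite rel_traceZ aE -rmorphM mulVf ?rmorph1 //.
by rewrite -(fmorph_eq0 iota) -aE rel_trace_eq0.
Qed.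

(** The relative trace of [iota z * w + iota u] is [iota z], which recovers z and then u;
    bijectivity follows by counting. *)
Lemma sum_decomp (w : L) (G : L -> int) : rel_trace m w = 1 ->
  \sum_x G x = \sum_(z : K) \sum_(u : K) G (iota z * w + iota u).
Proof.
move=> w1; rewrite pair_big /=.
pose h (p : K * K) := iota p.1 * w + iota p.2.
rewrite (reindex h) //; apply: onW_bij; apply: inj_card_bij.
  move=> [z u] [z' u'] E; have tr (p : K * K) : rel_trace m (h p) = iota p.1.
    rewrite rel_traceD rel_traceZ w1 mulr1.
    by have /eqP-> := etrans (rel_trace_eq0 (iota p.2)) (codom_f _ _); rewrite addr0.
  have /fmorph_inj /= ez : iota z = iota z' by rewrite -(tr (z, u)) E tr.
  by move: E; rewrite /h /= ez => /addrI/fmorph_inj->.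
by rewrite card_prod cardK cardL mul2n -addnn expnD.
Qed.

End RelativeTrace.

(** * Evaluation of the Walsh transform of [F] *)

Theorem theorem2 (m n r : nat) (hn : n = (2 * m)%N)
    (K L : finFieldType) (cardK : #|K| = (2 ^ m)%N) (cardL : #|L| = (2 ^ n)%N)
    (iota : {rmorphism K -> L})
    (Lam : {poly K}) (linLam : linearized Lam)
    (permLam : bijective (fun x : K => Lam.[x]))
    (F : L -> L)
    (FE : forall x : L,
        F x = x ^+ (2 ^ r) * rel_trace m (map_poly iota Lam).[x])
    (H : K -> K) (HE : forall x : K, H x = x ^+ (2 ^ r) * Lam.[x])
    (alpha : K) (alpha_neq0 : alpha != 0) (beta : L) :
  (beta \notin codom iota -> walsh n F (iota alpha) beta = 0) /\
  (forall b : K, beta = iota b ->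
     walsh n F (iota alpha) beta = 2 ^+ m * walsh m H alpha b).
Proof.
subst n.
have [T TE] := rel_trace_lift cardK cardL iota.
have [w w1] := rel_trace_eq1 cardK cardL iota.
have trK a : rel_trace m (iota a) = 0.
  by apply/eqP; rewrite (rel_trace_eq0 cardK cardL iota) codom_f.
have Th z u : T (iota z * w + iota u) = z.
  apply: (fmorph_inj iota); rewrite TE (rel_traceD cardL) (rel_traceZ cardK) w1.
  by rewrite trK mulr1 addr0.
(* The factors [alpha] and Lam(T x) lie in [K] and leave the relative trace, which then acts on
   x^(2^r) only. *)
have chiF x : chi (2 * m) (iota alpha * F x) = chi m (alpha * H (T x)).
  apply: (chi_rel_trace cardL (iota := iota)).
  rewrite FE (rel_trace_horner cardK cardL x TE linLam) [x ^+ _ * _]mulrC.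
  rewrite !(rel_traceZ cardK) (rel_traceX cardL) -TE HE.
  by rewrite !rmorphM rmorphXn [iota (T x) ^+ _ * _]mulrC.
have chib z u : chi (2 * m) (beta * (iota z * w + iota u))
    = chi (2 * m) (beta * (iota z * w)) * chi m (u * T beta).
  rewrite mulrDr (chiD cardL); congr (_ * _).
  apply: (chi_rel_trace cardL (iota := iota)).
  by rewrite [beta * _]mulrC (rel_traceZ cardK) rmorphM TE.
have walshF : walsh (2 * m) F (iota alpha) beta =
    \sum_z chi m (alpha * H z) * chi (2 * m) (beta * (iota z * w))
           * \sum_u chi m (u * T beta).
  rewrite walshE (sum_decomp cardK cardL iota _ w1); apply: eq_bigr => z _.
  rewrite mulr_sumr; apply: eq_bigr => u _.
  by rewrite chiF Th chib mulrA.
split=> [betaK|b bE]; rewrite walshF.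
  rewrite big1 // => z _; rewrite (sum_chi_mul cardK) ?mulr0 //.
  by rewrite -(fmorph_eq0 iota) TE (rel_trace_eq0 cardK cardL iota).
rewrite walshE mulr_sumr; apply: eq_bigr => z _.
have -> : T beta = 0 by apply: (fmorph_inj iota); rewrite TE bE trK rmorph0.
under eq_bigr => u _ do rewrite mulr0 chi0.
rewrite sumr_const cardT -cardE cardK natrX mulrC; congr (_ * (_ * _)).
(* With [beta] in [K] and [w] of relative trace 1, the argument has relative trace
   [iota (b * z)]. *)
apply: (chi_rel_trace cardL (iota := iota)).
by rewrite bE mulrA -rmorphM (rel_traceZ cardK) w1 mulr1.
Qed.
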